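(* Every semimedial left quasigroup has the LT property.
   Context: A left quasigroup is a (nonempty) set $Q$ with binary operations $*,\backslash$ such that $x*(x\backslash y)=y=x\backslash(x*y)$ for all $x,y$. It is semimedial if $(x*x)*(y*z)=(x*y)*(x*z)$ for all $x,y,z\in Q$. An LT term is a term of the form $$t(x_1,\ldots,x_n)=s_1(x_{i_1})\bullet_1(s_2(x_{i_2})\bullet_2(\ldots(s_{m-1}(x_{i_{m-1}})\bullet_{m-1}s_m(x_{i_m}))\ldots)),$$ where each $s_i$ is a unary term in the language $\{*,\backslash\}$ and $\bullet_i\in\{*,\backslash\}$. A left quasigroup $Q$ has the LT property if for every term $t$ in the language $\{*,\backslash\}$ there is an LT term $t'$ such that the identity $t\approx t'$ holds in $Q$. *)

(* Defs.v *)
From mathcomp Require Import all_boot.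

Set Implicit Arguments.
Unset Strict Implicit.
Unset Printing Implicit Defensive.

Declare Scope lq_scope.
Delimit Scope lq_scope with lq.

(* A plain record over Type rather than an extension of [magmaType], which would
   force a [choiceType] structure on the carrier. *)
Record left_quasigroup := LeftQuasigroup {
  carrier :> Type;
  lq_mul : carrier -> carrier -> carrier;
  lq_ldiv : carrier -> carrier -> carrier;
  lq_nonempty : inhabited carrier;
  lq_mulKV : forall x y, lq_mul x (lq_ldiv x y) = y;
  lq_mulK : forall x y, lq_ldiv x (lq_mul x y) = y
}.

Notation "x * y" := (lq_mul x y) : lq_scope.
Notation "x \ y" := (lq_ldiv x y)
  (at level 40, left associativity) : lq_scope.

Definition semimedial (Q : left_quasigroup) : Prop :=
  forall x y z : Q, ((x * x) * (y * z) = (x * y) * (x * z))%lq.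

Inductive lq_op := Mul | LDiv.

Inductive term (V : Type) :=
| Var of V
| App of lq_op & term V & term V.

Fixpoint subst (V W : Type) (f : V -> term W) (t : term V) : term W :=
  match t with
  | Var v => f v
  | App o t1 t2 => App o (subst f t1) (subst f t2)
  end.

Definition op_eval (Q : left_quasigroup) (o : lq_op) : Q -> Q -> Q :=
  match o with
  | Mul => @lq_mul Q
  | LDiv => @lq_ldiv Q
  end.

Fixpoint eval (Q : left_quasigroup) (V : Type) (e : V -> Q) (t : term V) : Q :=
  match t with
  | Var v => e v
  | App o t1 t2 => op_eval o (eval e t1) (eval e t2)
  end.

Definition identity_holds (Q : left_quasigroup) (V : Type) (t t' : term V) :
    Prop :=
  forall e : V -> Q, eval e t = eval e t'.

Definition unary_term := term unit.

Definition unary_at (V : Type) (s : unary_term) (x : V) : term V :=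
  subst (fun=> Var x) s.

(* [LT_unary] is the innermost factor s_m(x_{i_m}), so m >= 1. *)
Inductive is_LT (V : Type) : term V -> Prop :=
| LT_unary (s : unary_term) (x : V) : is_LT (unary_at s x)
| LT_app (o : lq_op) (s : unary_term) (x : V) (t : term V) :
    is_LT t -> is_LT (App o (unary_at s x) t).

(* Terms are built over the countable set of variables x_0, x_1, ... *)
Definition LT_property (Q : left_quasigroup) : Prop :=
  forall t : term nat,
    exists t' : term nat, is_LT t' /\ identity_holds Q t t'.

(* Main.v *)
(** Semimediality says L_(x * x) L_y = L_(x * y) L_x for the left translations L,
    so L_(x * y) = L_(x * x) L_y L_x^-1 and L_(x \ y) = L_(x * x)^-1 L_y L_x.
    Moreover squaring is an endomorphism, so t * t is t with every variable
    squared. By induction on t, L_t is therefore a product of left translations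
    by unary terms and of their inverses, whence t1 * t2 and t1 \ t2 are LT
    as soon as t2 is. *)

Require Import Defs.
From mathcomp Require Import all_boot.

Set Implicit Arguments.
Unset Strict Implicit.
Unset Printing Implicit Defensive.

Local Open Scope lq_scope.

(* The letter (o, s, x) stands for the translation y |-> s(x) o y. *)
Definition letter (V : Type) : Type := lq_op * unary_term * V.

Definition op_inv (o : lq_op) : lq_op := if o is Mul then LDiv else Mul.

Definition word_inv (V : Type) (w : seq (letter V)) : seq (letter V) :=
  rev [seq (op_inv a.1.1, a.1.2, a.2) | a <- w].

(** Squaring takes place inside the unary term, so s(x) becomes s(x * x) and each letter still
    involves a single variable. *)
Definition word_sq (V : Type) (w : seq (letter V)) : seq (letter V) :=
  [seq (a.1.1, subst (fun=> App Mul (Var tt) (Var tt)) a.1.2, a.2) | a <- w].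

Definition word_app (V : Type) (w : seq (letter V)) (t : term V) : term V :=
  foldr (fun a u => App a.1.1 (unary_at a.1.2 a.2) u) t w.

Lemma is_LT_word_app (V : Type) (w : seq (letter V)) (t : term V) :
  is_LT t -> is_LT (word_app w t).
Proof. by move=> LTt; elim: w => //= a w; apply: LT_app. Qed.

Lemma eval_subst (Q : left_quasigroup) (V W : Type) (f : V -> term W)
    (e : W -> Q) (t : term V) :
  eval e (subst f t) = eval (fun v => eval e (f v)) t.
Proof. by elim: t => //= o t1 -> t2 ->. Qed.

Section Action.
Variables (Q : left_quasigroup) (V : Type).
Implicit Types (e : V -> Q) (w : seq (letter V)) (y : Q) (t : term V).

Definition word_act e w y : Q :=
  foldr (fun a z => op_eval a.1.1 (eval (fun=> e a.2) a.1.2) z) y w.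

Lemma word_act_cat e w1 w2 y :
  word_act e (w1 ++ w2) y = word_act e w1 (word_act e w2 y).
Proof. exact: foldr_cat. Qed.

Lemma word_actK e w : cancel (word_act e w) (word_act e (word_inv w)).
Proof.
elim: w => //= -[[o s] x] w IHw y.
rewrite /word_inv /= rev_cons -cats1 word_act_cat /=.
by case: o; rewrite /= ?lq_mulK ?lq_mulKV IHw.
Qed.

Lemma word_act_sq e w y :
  word_act e (word_sq w) y = word_act (fun v => e v * e v) w y.
Proof. by elim: w => //= a w ->; rewrite eval_subst. Qed.

Lemma eval_word_app e w t : eval e (word_app w t) = word_act e w (eval e t).
Proof. by elim: w => //= a w ->; rewrite /unary_at eval_subst. Qed.

(** One word has to serve all valuations [e] at once; this uniformity is what permits passing to
    squared variables. *)
Definition translation_word t w : Prop :=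
  forall e y, eval e t * y = word_act e w y.

Lemma translation_word_inv t w :
  translation_word t w ->
  forall e y, eval e t \ y = word_act e (word_inv w) y.
Proof. by move=> tw e y; rewrite -{2}(lq_mulKV (eval e t) y) tw word_actK. Qed.

Hypothesis hQ : semimedial Q.

Lemma semimedial_mul (x y z : Q) : (x * y) * z = (x * x) * (y * (x \ z)).
Proof. by rewrite hQ lq_mulKV. Qed.

Lemma semimedial_ldiv (x y z : Q) : (x \ y) * z = (x * x) \ (y * (x * z)).
Proof. by rewrite -{2}(lq_mulKV x y) -hQ lq_mulK. Qed.

Lemma eval_sq e t : eval (fun v => e v * e v) t = eval e t * eval e t.
Proof.
elim: t => //= -[] t1 -> t2 -> /=; first exact: hQ.
(* With a, b the values of [t1], [t2], write both factors of b * b as a * (a \ b); semimediality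
   pulls out a * a, which cancels. *)
by rewrite -{1 2}(lq_mulKV (eval e t1) (eval e t2)) -hQ lq_mulK.
Qed.

Lemma translation_word_sq t w :
  translation_word t w -> translation_word (App Mul t t) (word_sq w).
Proof. by move=> tw e y; rewrite word_act_sq -tw eval_sq. Qed.

Lemma translation_word_exists t : exists w, translation_word t w.
Proof.
elim: t => [x | o t1 [w1 tw1] t2 [w2 tw2]]; first by exists [:: (Mul, Var tt, x)].
(* The square of [t1] is not a subterm, so its word comes from [w1] rather than from the
   induction. *)
have tw1s := translation_word_sq tw1.
case: o.
- exists (word_sq w1 ++ w2 ++ word_inv w1) => e y.
  by rewrite !word_act_cat -(translation_word_inv tw1) -tw2 -tw1s semimedial_mul.
- exists (word_inv (word_sq w1) ++ w2 ++ w1) => e y.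
  by rewrite !word_act_cat -tw1 -tw2 -(translation_word_inv tw1s) semimedial_ldiv.
Qed.

Lemma semimedial_LT t : exists t', is_LT t' /\ identity_holds Q t t'.
Proof.
(* The left factor enters only through its translation word, so the induction follows [t2] alone. *)
elim: t => [x | o t1 _ t2 [u [LTu eq_u]]].
  by exists (Var x); split=> //; apply: (LT_unary (Var tt) x).
have [w tw] := translation_word_exists t1.
case: o.
- exists (word_app w u); split=> [|e]; first exact: is_LT_word_app.
  by rewrite eval_word_app -eq_u -tw.
- exists (word_app (word_inv w) u); split=> [|e]; first exact: is_LT_word_app.
  by rewrite eval_word_app -eq_u -(translation_word_inv tw).
Qed.

End Action.

Theorem proposition3p2 (Q : left_quasigroup) (hQ : semimedial Q) : LT_property Q.
Proof. by move=> t; apply: semimedial_LT. Qed.
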